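(* Let $\mathcal{E}_R = \{(Q,c) \in \mathcal{S}^n \times \mathbb{R}^n : \ell^* = \ell^*_R\}$. Then $\mathcal{E}_R$ is the union of a finite number of polyhedral cones, and $$\mathcal{E}_R = \bigcup_{v \in V} \mathcal{O}_R(v) = \bigcup_{v \in V} \left( \bigcap_{\hat x \in V^+} \left\{ (Q,c) \in \mathcal{S}^n \times \mathbb{R}^n : \ell_R(v) \le \ell_R(\hat x) \right\} \right).$$
   Context: Let $n \ge 1$, let $\mathcal{S}^n$ be the space of real symmetric $n\times n$ matrices, $e \in \mathbb{R}^n$ the all-ones vector, $\langle A,B\rangle = \mathrm{trace}(A^TB)$; vector inequalities are componentwise. For $(Q,c) \in \mathcal{S}^n\times\mathbb{R}^n$ let $q(x) = \frac12 x^TQx + c^Tx$, $F = \{x \in \mathbb{R}^n : 0 \le x \le e\}$, and $\ell^* = \min_{x\in F} q(x)$ (the problem (BoxQP)). Let $$\mathcal{F}_R = \{(x,X)\in\mathbb{R}^n\times\mathcal{S}^n : 0\le x\le e,\ \max\{x_i+x_j-1,0\}\le X_{ij}\le \min\{x_i,x_j\},\ 1\le i\le j\le n\},$$ and $\ell^*_R = \min\{\frac12\langle Q,X\rangle + c^Tx : (x,X)\in\mathcal{F}_R\}$ (the RLT relaxation). For $\hat x\in F$ let $\ell_R(\hat x) = \min\{\frac12\langle Q,X\rangle + c^T\hat x : X \in\mathcal{S}^n,\ (\hat x,X)\in\mathcal{F}_R\}$ (this depends on $(Q,c)$), and $\mathcal{O}_R(\hat x) = \{(Q,c)\in\mathcal{S}^n\times\mathbb{R}^n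 : \ell_R(\hat x) = \ell^*_R\} = \{(Q,c) : \ell_R(\hat x)\le \ell_R(x)\ \forall x\in F\}$. Let $V = \{0,1\}^n$ be the set of vertices of $F$ and $V^+ = \{x\in F : x_j\in\{0,\frac12,1\},\ j=1,\dots,n\}$. *)

(* Defs.v *)
From HB Require Import structures.
From mathcomp Require Import all_boot all_order all_algebra.
From mathcomp Require Import all_classical all_reals.

Set Implicit Arguments.
Unset Strict Implicit.
Unset Printing Implicit Defensive.

Import Order.TTheory GRing.Theory Num.Theory.

Local Open Scope classical_set_scope.
Local Open Scope ring_scope.

Section BoxQP.
Variables (R : realType) (n : nat).

Definition symmetric_mx : set 'M[R]_n := [set A | A^T = A].

Definition mx_inner (A B : 'M[R]_n) : R := \tr (A^T *m B).

Definition dotv (u v : 'cV[R]_n) : R := (u^T *m v) 0 0.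

(* The data space S^n x R^n, as a subset of the space of all pairs (Q, c);
   every set of instances below is contained in it. *)
Definition instances : set ('M[R]_n * 'cV[R]_n) :=
  [set p | symmetric_mx p.1].

Definition quad (p : 'M[R]_n * 'cV[R]_n) (x : 'cV[R]_n) : R :=
  2^-1 * (x^T *m p.1 *m x) 0 0 + dotv p.2 x.

Definition box : set 'cV[R]_n := [set x | forall i, 0 <= x i 0 <= 1].

(* The minima are written as infima of sets of reals; they are all taken of
   continuous functions over nonempty compact sets (for [ell_R p x], as long
   as [box x] holds), so that [inf] is the minimum and never takes its default
   value. *)
Definition ell_star (p : 'M[R]_n * 'cV[R]_n) : R :=
  inf [set quad p x | x in box].

Definition rlt_feasible : set ('cV[R]_n * 'M[R]_n) :=
  [set z | [/\ symmetric_mx z.2, box z.1 &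
    forall i j : 'I_n, (i <= j)%N ->
      Num.max (z.1 i 0 + z.1 j 0 - 1) 0 <= z.2 i j
        <= Num.min (z.1 i 0) (z.1 j 0)]].

Definition rlt_obj (p : 'M[R]_n * 'cV[R]_n) (z : 'cV[R]_n * 'M[R]_n) : R :=
  2^-1 * mx_inner p.1 z.2 + dotv p.2 z.1.

Definition ell_star_R (p : 'M[R]_n * 'cV[R]_n) : R :=
  inf [set rlt_obj p z | z in rlt_feasible].

Definition ell_R (p : 'M[R]_n * 'cV[R]_n) (x : 'cV[R]_n) : R :=
  inf [set rlt_obj p (x, X) | X in [set X | rlt_feasible (x, X)]].

Definition opt_R (x : 'cV[R]_n) : set ('M[R]_n * 'cV[R]_n) :=
  [set p | instances p /\ ell_R p x = ell_star_R p].

Definition exact_R : set ('M[R]_n * 'cV[R]_n) :=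
  [set p | instances p /\ ell_star p = ell_star_R p].

Definition vertices : set 'cV[R]_n :=
  [set x | forall j, x j 0 = 0 \/ x j 0 = 1].

Definition half_vertices : set 'cV[R]_n :=
  [set x | box x /\ forall j, [\/ x j 0 = 0, x j 0 = 2^-1 | x j 0 = 1]].

(* Polyhedral cones of S^n x R^n: finite intersections of homogeneous closed
   half-spaces for the inner product <A, Q> + a^T c. *)
Definition polyhedral_cone (K : set ('M[R]_n * 'cV[R]_n)) : Prop :=
  exists (m : nat) (h : 'I_m -> 'M[R]_n * 'cV[R]_n),
    (forall k, instances (h k)) /\
    K = [set p | instances p /\
      forall k, mx_inner (h k).1 p.1 + dotv (h k).2 p.2 <= 0].

End BoxQP.

Arguments exact_R : clear implicits.
Arguments vertices : clear implicits.
Arguments half_vertices : clear implicits.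

(* Main.v *)
Require Import Defs.
From HB Require Import structures.
From mathcomp Require Import all_boot all_order all_algebra.
From mathcomp Require Import all_classical all_reals.
From mathcomp Require Import topology normedtype derive.
From mathcomp Require Import lra.

Set Implicit Arguments.
Unset Strict Implicit.
Unset Printing Implicit Defensive.

Import Order.TTheory GRing.Theory Num.Theory.
Import numFieldNormedType.Exports.

Local Open Scope classical_set_scope.
Local Open Scope ring_scope.

(** For a fixed x, each entry X_ij of a feasible matrix ranges over the interval
    with end points lo_ij = max (x_i + x_j - 1, 0) and hi_ij = min (x_i, x_j),
    independently of the other entries up to symmetry.  So ell_R has a closed
    form: put X_ij at lo_ij where Q_ij >= 0 and at hi_ij elsewhere.  This value
    is [rlt_value] ([ell_RE]); it never exceeds the quadratic objective, because
    X = x x^T is feasible, and it equals it at a vertex, where lo = hi = x_i x_j.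
    Everything below compares [rlt_value] and [quad].

    Exactness is witnessed by a vertex ([exact_RE]).  If ell_star = ell_star_R,
    take a minimizer x of the quadratic, which exists by compactness.  There the
    two objectives coincide, so every term Q_ij (x_i x_j - X_ij) of their
    difference vanishes.  For fractional x_i and x_j the product x_i x_j lies
    strictly between lo_ij and hi_ij, hence Q_ij = 0 ([rlt_value_eq_quad]).  The
    quadratic is therefore affine in the fractional coordinates of x, and these
    can be rounded to 0 or 1 without increasing it ([vertex_below]).  The vertex
    so obtained attains ell_star = ell_star_R.

    Testing against the half-integral points is enough ([half_vertex_below]).
    Unless x is half-integral, the least positive distance m of a coordinate of x
    to 1/2 is less than 1/2.  Then x is the convex combination, with weights 2m and 1 - 2m, of
    the half-integral point [push] x, in which every coordinate other than 1/2
    is pushed to the nearest of 0 and 1, and of a point [pull] x, in which the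
    coordinates at distance m have become 1/2.  On the coordinates of x and their
    complements to 1 both maps are nondecreasing, and they commute with
    a |-> 1 - a, so they preserve the sign of x_i + x_j - 1 and of
    x_i - x_j; lo and hi, and with them [rlt_value], are thus affine along this
    combination.  One of the two points does at least as well as x, and an
    induction on the number of coordinates other than 1/2 concludes.

    Finally, for a vertex v and a half-integral x, the inequality
    ell_R v <= ell_R x says that the quadratic objective at v, which is linear in
    (Q, c), is at most the objective at (x, X) for each of the finitely many
    symmetric X with entries in {lo_ij, hi_ij}.  So each set opt_R v is cut out
    by finitely many homogeneous linear inequalities ([opt_R_polyhedral]). *)

(** * Infima and continuity of finite sums *)

Lemma inf_attained (R : realType) (A : set R) (a : R) :
  A a -> lbound A a -> inf A = a.
Proof.
move=> Aa lba; apply/eqP; rewrite eq_le ge_inf//; last by exists a.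
by rewrite lb_le_inf//; exists a.
Qed.

Lemma continuous_sum (R : realType) (T : topologicalType) (I : Type)
    (r : seq I) (f : I -> T -> R) :
  (forall i, continuous (f i)) -> continuous (fun x => \sum_(i <- r) f i x).
Proof.
move=> fc; elim: r => [|i r IHr] x.
  by under eq_fun do rewrite big_nil; exact: cvg_cst.
by under eq_fun do rewrite big_cons; apply: continuousD; [exact: fc|exact: IHr].
Qed.

(** * The bounds on a single entry *)

Section PairBounds.
Variables (R : realType).

Definition pair_lo (a b : R) : R := Num.max (a + b - 1) 0.
Definition pair_hi (a b : R) : R := Num.min a b.

Lemma pair_loC a b : pair_lo a b = pair_lo b a.
Proof. by rewrite /pair_lo (addrC a). Qed.

Lemma pair_hiC a b : pair_hi a b = pair_hi b a.
Proof. by rewrite /pair_hi minC. Qed.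

Lemma pair_lo_mul (a b : R) : 0 <= a <= 1 -> 0 <= b <= 1 -> pair_lo a b <= a * b.
Proof.
move=> /andP[a0 a1] /andP[b0 b1]; rewrite /pair_lo ge_max mulr_ge0// andbT.
by nra.
Qed.

Lemma pair_mul_hi (a b : R) : 0 <= a <= 1 -> 0 <= b <= 1 -> a * b <= pair_hi a b.
Proof.
by move=> /andP[a0 a1] /andP[b0 b1]; rewrite /pair_hi le_min; apply/andP; split; nra.
Qed.

Lemma pair_lo_mul_lt (a b : R) : 0 < a < 1 -> 0 < b < 1 -> pair_lo a b < a * b.
Proof.
move=> /andP[a0 a1] /andP[b0 b1]; rewrite /pair_lo gt_max mulr_gt0// andbT.
by nra.
Qed.

Lemma pair_mul_hi_lt (a b : R) : 0 < a < 1 -> 0 < b < 1 -> a * b < pair_hi a b.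
Proof.
by move=> /andP[a0 a1] /andP[b0 b1]; rewrite /pair_hi lt_min; apply/andP; split; nra.
Qed.

Definition bit (a : R) := a = 0 \/ a = 1.

Lemma pair_lo_bit (a b : R) : bit a -> bit b -> pair_lo a b = a * b.
Proof.
rewrite /pair_lo => -[->|->] [->|->]; rewrite ?(mul0r, mulr0, mulr1, add0r, addr0).
- by apply/max_idPr; lra.
- by rewrite subrr maxxx.
- by rewrite subrr maxxx.
- by rewrite addrK; apply/max_idPl; lra.
Qed.

Lemma pair_hi_bit (a b : R) : bit a -> bit b -> pair_hi a b = a * b.
Proof.
rewrite /pair_hi => -[->|->] [->|->]; rewrite ?(mul0r, mulr0, mulr1) ?minxx//.
- by apply/min_idPl; lra.
- by apply/min_idPr; lra.
Qed.

End PairBounds.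

(** * The closed form of the relaxation at a fixed point *)

Section Relaxation.
Variables (R : realType) (n : nat).
Implicit Types (p : 'M[R]_n * 'cV[R]_n) (x : 'cV[R]_n) (X : 'M[R]_n).

Lemma mx_innerE (A B : 'M[R]_n) : mx_inner A B = \sum_i \sum_j A i j * B i j.
Proof.
rewrite /mx_inner /mxtrace exchange_big; apply: eq_bigr => i _.
by rewrite !mxE; apply: eq_bigr => j _; rewrite !mxE.
Qed.

Lemma dotvE (u v : 'cV[R]_n) : dotv u v = \sum_i u i 0 * v i 0.
Proof. by rewrite /dotv !mxE; apply: eq_bigr => i _; rewrite !mxE. Qed.

Lemma quad_rlt_obj p x : quad p x = rlt_obj p (x, x *m x^T).
Proof.
rewrite /quad /rlt_obj /=; congr (_ * _ + _).
rewrite -mulmxA mxE mx_innerE; apply: eq_bigr => i _.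
rewrite !mxE mulr_sumr; apply: eq_bigr => j _.
by rewrite !mxE big_ord1 !mxE mulrCA.
Qed.

(** The test is symmetrized so that [corner x s] is a symmetric matrix for every
    bit matrix [s]; this makes the finite type of all bit matrices usable as an
    index set for the extreme choices of X. *)
Definition corner x (s : 'M[bool]_n) : 'M[R]_n :=
  \matrix_(i, j) if s i j || s j i then pair_lo (x i 0) (x j 0)
                 else pair_hi (x i 0) (x j 0).

Definition sign_pattern p : 'M[bool]_n := \matrix_(i, j) (0 <= p.1 i j).

Definition rlt_value p x : R := rlt_obj p (x, corner x (sign_pattern p)).

(** The definition of feasibility bounds only the entries with i <= j; symmetry
    of X and of the bounds gives the others. *)
Lemma pair_boundsP x X : box x -> symmetric_mx X ->
  rlt_feasible (x, X) <->
  forall i j, pair_lo (x i 0) (x j 0) <= X i j <= pair_hi (x i 0) (x j 0).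
Proof.
move=> bx sX; split => [[_ _ H] i j|H]; last by split => // i j _; exact: H.
have [ij|/ltnW ji] := leqP i j; first exact: H ij.
by rewrite pair_loC pair_hiC -sX mxE; exact: H ji.
Qed.

Lemma corner_feasible x s : box x -> rlt_feasible (x, corner x s).
Proof.
move=> bx; apply/pair_boundsP => //.
  by apply/matrixP => i j; rewrite !mxE orbC pair_loC pair_hiC.
move=> i j; have lh : pair_lo (x i 0) (x j 0) <= pair_hi (x i 0) (x j 0).
  exact: le_trans (pair_lo_mul _ _) (pair_mul_hi _ _).
by rewrite mxE; case: ifP => _; rewrite lexx lh.
Qed.

Lemma outer_feasible x : box x -> rlt_feasible (x, x *m x^T).
Proof.
move=> bx; apply/pair_boundsP => //; first by rewrite /symmetric_mx/= trmx_mul trmxK.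
by move=> i j; rewrite !mxE big_ord1 !mxE pair_lo_mul//= pair_mul_hi.
Qed.

Lemma sign_patternE p i j : instances p ->
  sign_pattern p i j || sign_pattern p j i = (0 <= p.1 i j).
Proof.
by rewrite /instances/symmetric_mx/= => sp; rewrite !mxE -{2}sp mxE orbb.
Qed.

Lemma corner_gap_ge0 p x X : instances p -> rlt_feasible (x, X) ->
  forall i j, 0 <= p.1 i j * (X i j - corner x (sign_pattern p) i j).
Proof.
move=> ip fX i j; have [sX bx _] := fX.
have /andP[lX Xh] := (pair_boundsP bx sX).1 fX i j.
rewrite mxE sign_patternE//; case: (lerP 0 (p.1 i j)) => Q.
  by rewrite mulr_ge0// subr_ge0.
by rewrite mulr_le0// ?subr_le0// ltW.
Qed.

Lemma rlt_obj_sub p x X Y : rlt_obj p (x, X) - rlt_obj p (x, Y) =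
  2^-1 * \sum_i \sum_j p.1 i j * (X i j - Y i j).
Proof.
rewrite /rlt_obj /= opprD addrACA subrr addr0 -mulrBr !mx_innerE -sumrB.
congr (_ * _); apply: eq_bigr => i _; rewrite -sumrB.
by apply: eq_bigr => j _; rewrite mulrBr.
Qed.

Lemma rlt_value_le p x X : instances p -> rlt_feasible (x, X) ->
  rlt_value p x <= rlt_obj p (x, X).
Proof.
move=> ip fX; rewrite -subr_ge0 rlt_obj_sub mulr_ge0 ?invr_ge0//.
by apply: sumr_ge0 => i _; apply: sumr_ge0 => j _; exact: corner_gap_ge0.
Qed.

Lemma rlt_value_le_quad p x : instances p -> box x -> rlt_value p x <= quad p x.
Proof.
by move=> ip bx; rewrite quad_rlt_obj rlt_value_le//; exact: outer_feasible.
Qed.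

Lemma ell_RE p x : instances p -> box x -> ell_R p x = rlt_value p x.
Proof.
move=> ip bx; apply: inf_attained.
  by exists (corner x (sign_pattern p)) => //; exact: corner_feasible.
by move=> _ [X fX <-]; exact: rlt_value_le.
Qed.

(** Equality of the objectives forces each of the nonnegative terms
    Q_ij (x_i x_j - corner_ij) to be 0, and the second factor is nonzero when both
    coordinates are fractional because the bounds are then strict.  The case
    i = j is included: it relies on max (2 x_i - 1, 0) < x_i ^ 2 < x_i. *)
Lemma rlt_value_eq_quad p x i j : instances p -> box x ->
  rlt_value p x = quad p x -> 0 < x i 0 < 1 -> 0 < x j 0 < 1 -> p.1 i j = 0.
Proof.
move=> ip bx /eqP; rewrite eq_sym -subr_eq0 quad_rlt_obj rlt_obj_sub.
rewrite mulf_eq0 invr_eq0 pnatr_eq0/= => S0 xi xj.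
have ge0 := corner_gap_ge0 ip (outer_feasible bx).
have := ge0 i j; move: S0.
rewrite psumr_eq0 => [/allP/(_ i)|k _]; last exact: sumr_ge0.
rewrite mem_index_enum => /(_ isT)/=.
rewrite psumr_eq0 => [/allP/(_ j)|//].
rewrite mem_index_enum => /(_ isT)/=; rewrite mulf_eq0 => /orP[/eqP//|].
rewrite subr_eq0 !mxE big_ord1 !mxE.
have := pair_lo_mul_lt xi xj; have := pair_mul_hi_lt xi xj.
by case: ifP => _; [move=> _ /gt_eqF->|move=> /lt_eqF-> _].
Qed.

Lemma vertex_box x : vertices R n x -> box x.
Proof. by move=> vx i; case: (vx i) => ->; rewrite ?lexx ler01. Qed.

Lemma vertex_half x : vertices R n x -> half_vertices R n x.
Proof.
move=> vx; split; first exact: vertex_box.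
by move=> j; case: (vx j) => ->; [apply: Or31|apply: Or33].
Qed.

Lemma corner_vertex x s : vertices R n x -> corner x s = x *m x^T.
Proof.
move=> vx; apply/matrixP => i j; rewrite !mxE big_ord1 !mxE.
by rewrite pair_lo_bit ?pair_hi_bit ?if_same//; exact: vx.
Qed.

Lemma rlt_value_vertex p x : vertices R n x -> rlt_value p x = quad p x.
Proof. by move=> vx; rewrite quad_rlt_obj /rlt_value corner_vertex. Qed.

End Relaxation.

(** * Splitting a coordinate into a half-integral and a residual part *)

Section PushPull.
Variables (R : realType).

(** The values on which [pull m] is nondecreasing: one at positive distance less
    than m from 1/2 would be carried to the opposite side of 1/2. *)
Definition away (m a : R) := [\/ a <= 2^-1 - m, a = 2^-1 | 2^-1 + m <= a].
Definition push (a : R) : R := 2^-1 + Num.sg (a - 2^-1) / 2.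
(** The point that remains after giving weight 2m to [push a]; see [push_pull].
    The factor 2m is chosen so that a value at distance m from 1/2 becomes 1/2. *)
Definition pull (m a : R) : R := (a - 2 * m * push a) / (1 - 2 * m).

Lemma push_low (a : R) : a < 2^-1 -> push a = 0.
Proof. by move=> h; rewrite /push ltr0_sg ?subr_lt0//; lra. Qed.

Lemma push_half : push 2^-1 = 2^-1.
Proof. by rewrite /push subrr sgr0 mul0r addr0. Qed.

Lemma push_high (a : R) : 2^-1 < a -> push a = 1.
Proof. by move=> h; rewrite /push gtr0_sg ?subr_gt0//; lra. Qed.

Lemma push_compl (a : R) : push (1 - a) = 1 - push a.
Proof.
rewrite /push (_ : 1 - a - 2^-1 = - (a - 2^-1)); last by lra.
by rewrite sgrN; lra.
Qed.

Variable m : R.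
Hypothesis m_itv : 0 < m < 2^-1.

Lemma away_compl (a : R) : away m a -> away m (1 - a).
Proof. by move=> [h|->|h]; [apply: Or33|apply: Or32|apply: Or31]; lra. Qed.

Lemma away_push (a : R) : away m a ->
  [\/ a <= 2^-1 - m /\ push a = 0, a = 2^-1 /\ push a = 2^-1
    | 2^-1 + m <= a /\ push a = 1].
Proof.
move/andP: m_itv => [m0 m1] [h|->|h]; [apply: Or31|apply: Or32|apply: Or33].
- by split=> //; apply: push_low; lra.
- by split=> //; exact: push_half.
- by split=> //; apply: push_high; lra.
Qed.

Lemma scale_neq0 : 1 - 2 * m != 0.
Proof. by move/andP: m_itv => [m0 m1]; apply: lt0r_neq0; lra. Qed.

Lemma push_pull (a : R) : a = 2 * m * push a + (1 - 2 * m) * pull m a.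
Proof. by rewrite /pull mulrCA divff ?scale_neq0// mulr1 subrKC. Qed.

Lemma pull_compl (a : R) : pull m (1 - a) = 1 - pull m a.
Proof.
apply: (mulfI scale_neq0); have := push_pull a; have := push_pull (1 - a).
by rewrite push_compl; lra.
Qed.

Lemma pull_half : pull m 2^-1 = 2^-1.
Proof.
by apply: (mulfI scale_neq0); have := push_pull 2^-1; rewrite push_half; lra.
Qed.

Lemma pull_nearest (a : R) : `|a - 2^-1| = m -> pull m a = 2^-1.
Proof.
move/andP: m_itv => [m0 m1] am; apply: (mulfI scale_neq0).
have := push_pull a; move: am.
have [h|h] := ltrP (a - 2^-1) 0.
  by rewrite ltr0_norm// push_low; lra.
by rewrite ger0_norm// => am; rewrite push_high; lra.
Qed.

(** Together with compatibility with a |-> 1 - a, this shows that [push] and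
    [pull m] respect the two comparisons, a <= b and 1 - b <= a, that decide which
    affine piece of [pair_hi] and [pair_lo] is active. *)
Lemma push_pull_homo (a b : R) : away m a -> away m b -> a <= b ->
  push a <= push b /\ pull m a <= pull m b.
Proof.
move=> awa awb ab.
have s0 : 0 < 1 - 2 * m by move/andP: m_itv => [m0 m1]; lra.
rewrite -(ler_pM2l s0 (pull m a)).
have pa := push_pull a; have pb := push_pull b.
move: (pull m a) (pull m b) pa pb => u w; move/andP: m_itv => [m0 m1].
by case: (away_push awa) => -[ha ->]; case: (away_push awb) => -[hb ->] pa pb;
  split; lra.
Qed.

Lemma pull_itv (a : R) : away m a -> 0 <= a <= 1 -> 0 <= pull m a <= 1.
Proof.
move=> awa /andP[a0 a1]; move/andP: m_itv => [m0 m1].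
have aw0 : away m 0 by apply: Or31; lra.
have aw1 : away m 1 by apply: Or33; lra.
have p0 : pull m 0 = 0 by rewrite /pull push_low; lra.
have p1 : pull m 1 = 1.
  by rewrite /pull push_high ?mulr1 ?divff ?scale_neq0//; lra.
have [_] := push_pull_homo aw0 awa a0; have [_] := push_pull_homo awa aw1 a1.
by rewrite p0 p1 => -> ->.
Qed.

Lemma pair_lo_push_pull (a b : R) : away m a -> away m b ->
  pair_lo a b = 2 * m * pair_lo (push a) (push b)
                + (1 - 2 * m) * pair_lo (pull m a) (pull m b).
Proof.
move=> awa awb; move/andP: (m_itv) => [m0 m1].
rewrite /pair_lo !maxr_pMr ?mulr0; [|lra|lra].
have [ba|ab] := lerP (1 - b) a.
  have [] := push_pull_homo (away_compl awb) awa ba.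
  rewrite push_compl pull_compl => h1 h2.
  rewrite !max_l ?mulr_ge0//; [|nra..].
  by rewrite {1}(push_pull a) {1}(push_pull b); lra.
have [] := push_pull_homo awa (away_compl awb) (ltW ab).
rewrite push_compl pull_compl => h1 h2.
by rewrite !max_r ?addr0//; nra.
Qed.

Lemma pair_hi_push_pull (a b : R) : away m a -> away m b ->
  pair_hi a b = 2 * m * pair_hi (push a) (push b)
                + (1 - 2 * m) * pair_hi (pull m a) (pull m b).
Proof.
wlog ab : a b / a <= b => [wl awa awb|awa awb].
  case: (leP a b) => [ab|/ltW ba]; first exact: wl.
  by rewrite pair_hiC wl// (pair_hiC (push b)) (pair_hiC (pull m b)).
have [h1 h2] := push_pull_homo awa awb ab.
by rewrite /pair_hi !min_l// -push_pull.
Qed.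

End PushPull.

(** * Half-integral and integral minimizers *)

Section Exactness.
Variables (R : realType) (n : nat).
Implicit Types (p : 'M[R]_n * 'cV[R]_n) (x : 'cV[R]_n) (X : 'M[R]_n).

(** The objective is linear in (x, X) jointly. *)
Lemma rlt_obj_convex p t x y z X Y Z :
  x = t *: y + (1 - t) *: z -> X = t *: Y + (1 - t) *: Z ->
  rlt_obj p (x, X) = t * rlt_obj p (y, Y) + (1 - t) * rlt_obj p (z, Z).
Proof.
move=> -> ->; rewrite /rlt_obj /mx_inner /dotv /=.
rewrite !mulmxDr -!scalemxAr mxtraceD !mxtraceZ !mxE; lra.
Qed.

(** The induction is on the number of coordinates other than 1/2; it decreases
    since [pull] fixes 1/2 and sends the coordinate nearest to 1/2 onto it. *)
Lemma half_vertex_below p x : box x ->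
  exists2 z, half_vertices R n z & rlt_value p z <= rlt_value p x.
Proof.
have [k] := ubnP #|[pred i | x i 0 != 2^-1]|.
elim: k x => // k IHk x; rewrite ltnS => xk bx.
have [hx|nhx] := pselect (half_vertices R n x); first by exists x.
(* A coordinate outside {0, 1/2, 1} makes the least distance m less than 1/2. *)
have [j xj] : exists j, ~ [\/ x j 0 = 0, x j 0 = 2^-1 | x j 0 = 1].
  by apply/existsNP => h; apply: nhx; split.
have jP : x j 0 != 2^-1 by apply/eqP => h; apply: xj; apply: Or32.
case: (@arg_minP _ _ _ j [pred i | x i 0 != 2^-1] (fun i => `|x i 0 - 2^-1|) jP).
move=> i /= iP imin; set m := `|x i 0 - 2^-1| in imin.
have m_itv : 0 < m < 2^-1.
  rewrite normr_gt0 subr_eq0 iP/= (le_lt_trans (imin j jP))// ltr_norml.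
  have /andP[x0 x1] := bx j; apply/andP; split.
    have : 0 != x j 0 by apply/eqP => h; apply: xj; apply: Or31.
    by lra.
  have : x j 0 != 1 by apply/eqP => h; apply: xj; apply: Or33.
  by lra.
have awx l : away m (x l 0).
  have [->|lP] := eqVneq (x l 0) 2^-1; first exact: Or32.
  by have := imin l lP; rewrite ler_normr => /orP[h|h]; [apply: Or33|apply: Or31]; lra.
pose y := map_mx (@push R) x; pose z := map_mx (pull m) x.
have y_half : half_vertices R n y.
  have : forall l, [\/ y l 0 = 0, y l 0 = 2^-1 | y l 0 = 1].
    move=> l; rewrite mxE.
    by case: (away_push m_itv (awx l)) => -[_ ->]; [apply: Or31|apply: Or32|apply: Or33].
  by move=> hy; split=> // l; case: (hy l) => ->; lra.
have bz : box z by move=> l; rewrite mxE pull_itv.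
have vx : rlt_value p x = 2 * m * rlt_value p y + (1 - 2 * m) * rlt_value p z.
  apply: rlt_obj_convex.
    by apply/colP => l; rewrite !mxE -push_pull.
  apply/matrixP => l l'; rewrite !mxE; case: ifP => _.
    exact: pair_lo_push_pull.
  exact: pair_hi_push_pull.
have [yx|xy] := leP (rlt_value p y) (rlt_value p x); first by exists y.
have zx : rlt_value p z <= rlt_value p x by move/andP: m_itv => [m0 m1]; nra.
suff /IHk/(_ bz)[w hw wz] : (#|[pred l | z l 0%R != 2^-1]| < k)%N.
  by exists w => //; exact: le_trans zx.
apply: leq_trans xk; apply: proper_card; apply/properP; split.
  apply/fintype.subsetP => l; rewrite !inE mxE; apply: contraNN => /eqP->.
  by rewrite pull_half.
exists i; rewrite ?inE//= negbK mxE.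
by rewrite pull_nearest.
Qed.

Lemma quad_sum p x : quad p x =
  2^-1 * (\sum_i \sum_j p.1 i j * (x i 0 * x j 0)) + \sum_i p.2 i 0 * x i 0.
Proof.
rewrite quad_rlt_obj /rlt_obj /= mx_innerE dotvE; congr (_ * _ + _).
by apply: eq_bigr => i _; apply: eq_bigr => j _; rewrite !mxE big_ord1 !mxE.
Qed.

Lemma continuous_quad (T : topologicalType) p (x : T -> 'cV[R]_n) :
  (forall i, continuous (fun t => x t i 0)) -> continuous (fun t => quad p (x t)).
Proof.
move=> xc.
have cD (f g : T -> R) : continuous f -> continuous g ->
    continuous (fun t => f t + g t).
  by move=> fc gc t; apply: continuousD; [exact: fc|exact: gc].
have cM (f g : T -> R) : continuous f -> continuous g ->
    continuous (fun t => f t * g t).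
  by move=> fc gc t; apply: continuousM; [exact: fc|exact: gc].
have cC (a : R) : continuous (fun _ : T => a) by move=> t; exact: cvg_cst.
under eq_fun do rewrite quad_sum.
apply: cD; last by apply: continuous_sum => i; apply: (cM).
apply: (cM) => //; apply: continuous_sum => i; apply: continuous_sum => j.
by apply: (cM) => //; apply: (cM).
Qed.

(** The only use of compactness: the half-integral argument covers the
    relaxation but not the quadratic, whose minimizer need
    not be half-integral. *)
Lemma quad_attained p :
  exists2 x, box x & forall y, box y -> quad p x <= quad p y.
Proof.
pose A := [set v : 'rV[R]_n | forall i, `[0, 1]%classic (v ord0 i)].
have [|||v vA vmin] := @EVT_min_rV R n (fun v => quad p v^T) A.
- by exists 0 => i /=; rewrite mxE in_itv/= lexx ler01.
- by apply: (@rV_compact R n (fun=> `[0, 1]%classic)) => i; exact: segment_compact.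
- apply/continuous_subspaceT/continuous_quad => i.
  by under eq_fun do rewrite mxE; exact: coord_continuous.
exists v^T => [i|y yb]; first by rewrite mxE; move: (set_mem vA i); rewrite /= in_itv.
rewrite -[y]trmxK; apply: vmin.
by rewrite inE => i /=; rewrite in_itv/= mxE; exact: yb.
Qed.

Lemma quad_add p x d : instances p ->
  quad p (x + d) = quad p x + dotv (p.1 *m x + p.2) d + 2^-1 * (d^T *m p.1 *m d) 0 0.
Proof.
rewrite /instances/symmetric_mx/= => sp.
have xd : x^T *m p.1 *m d = (d^T *m p.1 *m x)^T by rewrite !trmx_mul trmxK sp mulmxA.
have -> : dotv (p.1 *m x + p.2) d = (d^T *m p.1 *m x) 0 0 + dotv p.2 d.
  rewrite /dotv [(_ + _)^T]linearD/= mulmxDl trmx_mul sp mxE; congr (_ + _).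
  by rewrite xd mxE.
rewrite /quad /dotv [(x + d)^T]linearD/= !mulmxDl !mulmxDr xd !mxE.
lra.
Qed.

(** Let d be the change made by rounding; it is supported on the fractional
    coordinates, where Q vanishes, so the second-order term d^T Q d is 0.  Rounding
    each fractional coordinate against the sign of the gradient Q x + c makes the
    first-order term nonpositive. *)
Lemma vertex_below p x : instances p -> box x ->
  (forall i j, 0 < x i 0 < 1 -> 0 < x j 0 < 1 -> p.1 i j = 0) ->
  exists2 v, vertices R n v & quad p v <= quad p x.
Proof.
move=> ip bx Q0; pose g := p.1 *m x + p.2.
pose v : 'cV[R]_n := \col_i if 0 < x i 0 < 1 then (g i 0 < 0)%R%:R else x i 0.
pose d := v - x.
have d0 i : ~~ (0 < x i 0 < 1) -> d i 0 = 0.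
  by move=> /negbTE xi; rewrite !mxE xi subrr.
exists v => [i|].
  rewrite mxE; case: ifPn => [_|]; first by case: (_ < 0); [right|left].
  have /andP[x0 x1] := bx i; rewrite negb_and -!leNgt => /orP[x0'|x1'].
    by left; apply/le_anti; rewrite x0 x0'.
  by right; apply/le_anti; rewrite x1 x1'.
rewrite -[v](subrKC x) -/d quad_add// -addrA gerDl.
have -> : (d^T *m p.1 *m d) 0 0 = 0.
  rewrite mxE big1// => j _; have [xj|xj] := boolP (0 < x j 0 < 1); last first.
    by rewrite (d0 j)// mulr0.
  rewrite mxE big1 ?mul0r// => i _; have [xi|xi] := boolP (0 < x i 0 < 1).
    by rewrite Q0// mulr0.
  by rewrite mxE d0// mul0r.
rewrite mulr0 addr0 dotvE; apply: sumr_le0 => i _; rewrite -/g.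
have [xi|xi] := boolP (0 < x i 0 < 1); last by rewrite d0// mulr0.
have -> : d i 0 = (g i 0 < 0)%R%:R - x i 0 by rewrite !mxE xi.
move/andP: xi => [x0 x1].
case: ltP => gi /=; first by rewrite mulr_le0_ge0 ?subr_ge0 ?ltW.
by rewrite mulr_ge0_le0// subr_le0 ltW.
Qed.

(** Finite types indexing the half-integral points and the vertices: they give
    the minimum over the former and the finite union and intersections of the
    polyhedral description. *)
Definition half_point (f : {ffun 'I_n -> 'I_3}) : 'cV[R]_n := \col_i ((f i)%:R / 2).

Definition vertex_point (f : {ffun 'I_n -> bool}) : 'cV[R]_n := \col_i (f i)%:R.

Lemma half_point_half f : half_vertices R n (half_point f).
Proof.
have h i : [\/ half_point f i 0 = 0, half_point f i 0 = 2^-1 | half_point f i 0 = 1].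
  rewrite mxE; case: (f i) => -[|[|[|//]]] ? /=.
  - by apply: Or31; rewrite mul0r.
  - by apply: Or32; rewrite mul1r.
  - by apply: Or33; rewrite divff ?pnatr_eq0.
by split=> // i; case: (h i) => ->; lra.
Qed.

Lemma half_pointP x : half_vertices R n x -> exists f, x = half_point f.
Proof.
move=> [_ hx].
have /choice[f fE] : forall i, exists k : 'I_3, x i 0 = k%:R / 2.
  move=> i; case: (hx i) => ->; [exists 0|exists 1|exists (inord 2)].
  - by rewrite mul0r.
  - by rewrite mul1r.
  - by rewrite inordK// divff ?pnatr_eq0.
by exists (finfun f); apply/colP => i; rewrite mxE ffunE.
Qed.

Lemma vertex_point_vertex f : vertices R n (vertex_point f).
Proof. by move=> i; rewrite mxE; case: (f i); [right|left]. Qed.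

Lemma vertex_pointP x : vertices R n x -> exists f, x = vertex_point f.
Proof.
move=> vx; exists [ffun i => x i 0 == 1]; apply/colP => i; rewrite mxE ffunE.
by case: (vx i) => ->; rewrite ?eqxx// eq_sym oner_eq0.
Qed.

(** A minimum over the finitely many half-integral points is a minimum over the
    whole box by [half_vertex_below]. *)
Lemma rlt_value_attained p :
  exists2 x, box x & forall y, box y -> rlt_value p x <= rlt_value p y.
Proof.
case: (@arg_minP _ _ _ [ffun=> ord0] xpredT (fun f => rlt_value p (half_point f)) isT).
move=> f _ fmin; exists (half_point f); first by have [] := half_point_half f.
move=> y by_; have [z hz zy] := half_vertex_below p by_.
by apply: le_trans zy; have [g ->] := half_pointP hz; exact: fmin.
Qed.

Lemma ell_star_RE p x : instances p -> box x ->
  (forall y, box y -> rlt_value p x <= rlt_value p y) -> ell_star_R p = rlt_value p x.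
Proof.
move=> ip bx xmin; apply: inf_attained.
  by exists (x, corner x (sign_pattern p)) => //; exact: corner_feasible.
move=> _ [[y Y] fY <-]; have [_ by_ _] := fY.
exact: le_trans (xmin y by_) (rlt_value_le ip fY).
Qed.

Lemma ell_starE p x : box x -> (forall y, box y -> quad p x <= quad p y) ->
  ell_star p = quad p x.
Proof.
by move=> bx xmin; apply: inf_attained; [exists x|move=> _ [y by_ <-]; exact: xmin].
Qed.

Lemma ell_star_R_le p x : instances p -> box x -> ell_star_R p <= rlt_value p x.
Proof.
move=> ip bx; have [y by_ ymin] := rlt_value_attained p.
by rewrite (ell_star_RE ip by_ ymin) ymin.
Qed.

Lemma opt_RE p x : instances p -> box x ->
  opt_R x p <-> forall y, half_vertices R n y -> rlt_value p x <= rlt_value p y.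
Proof.
move=> ip bx; split => [[_ ]|xmin].
  by rewrite ell_RE// => -> y [by_ _]; exact: ell_star_R_le.
split=> //; rewrite ell_RE//; apply/esym/ell_star_RE => // y by_.
by have [z hz] := half_vertex_below p by_; apply: le_trans; exact: xmin.
Qed.

(** From left to right, round a minimizer of the quadratic.  From right to left,
    ell_star_R is the value of the quadratic at a vertex, and ell_star_R is a lower
    bound of the quadratic over the box. *)
Lemma exact_RE : exact_R R n = \bigcup_(v in vertices R n) opt_R v.
Proof.
apply/seteqP; split => p.
  move=> [ip ex]; have [x bx xmin] := quad_attained p.
  have lsR : ell_star_R p = quad p x by rewrite -ex (ell_starE bx xmin).
  have xval : rlt_value p x = quad p x.
    by apply/le_anti; rewrite rlt_value_le_quad//= -lsR ell_star_R_le.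
  have [v vv vx] := vertex_below ip bx (fun i j => rlt_value_eq_quad ip bx xval).
  have bv := vertex_box vv.
  exists v => //; split => //; rewrite ell_RE//; apply/le_anti.
  by rewrite ell_star_R_le// andbT rlt_value_vertex// lsR.
move=> [v vv [ip]]; have bv := vertex_box vv.
rewrite ell_RE// rlt_value_vertex// => ev; split => //.
rewrite -ev; apply: ell_starE => // y by_; rewrite ev.
exact: le_trans (ell_star_R_le ip by_) (rlt_value_le_quad ip by_).
Qed.

Lemma polyhedral_cone_fin (I : finType) (h : I -> 'M[R]_n * 'cV[R]_n) :
  (forall k, instances (h k)) ->
  polyhedral_cone [set p | instances p /\
    forall k, mx_inner (h k).1 p.1 + dotv (h k).2 p.2 <= 0].
Proof.
move=> ih; exists #|I|, (h \o enum_val); split=> [k|]; first exact: ih.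
apply/seteqP; split=> p [ip hp]; split=> // k; first exact: hp.
by rewrite -[k]enum_rankK; exact: hp.
Qed.

Lemma rlt_value_le_corner p x s : instances p -> box x ->
  rlt_value p x <= rlt_obj p (x, corner x s).
Proof. by move=> ip bx; apply: rlt_value_le => //; exact: corner_feasible. Qed.

(** A difference of two objective values as a linear form in p: the coefficient
    pair on the left is what a half-space in [polyhedral_cone] asks for. *)
Lemma rlt_obj_diff p x y X Y :
  mx_inner (2^-1 *: (X - Y)) p.1 + dotv (x - y) p.2 =
  rlt_obj p (x, X) - rlt_obj p (y, Y).
Proof.
rewrite /rlt_obj/= opprD addrACA -mulrBr !mx_innerE !dotvE -!sumrB mulr_sumr.
congr (_ + _); apply: eq_bigr => i _; last by rewrite !mxE; lra.
by rewrite -sumrB mulr_sumr; apply: eq_bigr => j _; rewrite !mxE; lra.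
Qed.

(** [rlt_value p x] is the least of the values at the corners over x, attained at
    the corner [sign_pattern p], so being below it means being below all of
    them; each of these conditions is a half-space in p. *)
Lemma opt_R_polyhedral v : vertices R n v -> polyhedral_cone (@opt_R R n v).
Proof.
move=> vv; have bv := vertex_box vv.
pose h (k : {ffun 'I_n -> 'I_3} * 'M[bool]_n) : 'M[R]_n * 'cV[R]_n :=
  (2^-1 *: (v *m v^T - corner (half_point k.1) k.2), v - half_point k.1).
suff -> : opt_R v = [set p | instances p /\
    forall k, mx_inner (h k).1 p.1 + dotv (h k).2 p.2 <= 0].
  apply: polyhedral_cone_fin => -[f s]; rewrite /instances/symmetric_mx/=.
  have [sc _ _] := corner_feasible s (half_point_half f).1.
  by rewrite linearZ/= linearB/= trmx_mul trmxK sc.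
apply/seteqP; split => p.
  move=> vp; have [ip _] := vp; split => // -[f s].
  rewrite rlt_obj_diff subr_le0 -quad_rlt_obj -rlt_value_vertex//.
  apply: le_trans (rlt_value_le_corner s ip (half_point_half f).1).
  exact/(opt_RE ip bv).1/half_point_half.
move=> [ip hp]; apply/opt_RE => // x /half_pointP[f ->].
have := hp (f, sign_pattern p).
by rewrite rlt_obj_diff subr_le0 -quad_rlt_obj -rlt_value_vertex.
Qed.

End Exactness.

Theorem proposition4p3 (R : realType) (n : nat) (hn : (1 <= n)%N) :
  [/\ (exists (m : nat) (K : 'I_m -> set ('M[R]_n * 'cV[R]_n)),
         (forall k, polyhedral_cone (K k)) /\
         exact_R R n = \bigcup_(k in [set: 'I_m]) K k),
      exact_R R n = \bigcup_(v in vertices R n) opt_R v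
    & exact_R R n =
        \bigcup_(v in vertices R n) \bigcap_(x in half_vertices R n)
          [set p : 'M[R]_n * 'cV[R]_n |
             instances p /\ ell_R p v <= ell_R p x] ].
Proof.
split; last 2 first.
- exact: exact_RE.
- rewrite exact_RE; apply: eq_bigcupr => v vv; have bv := vertex_box vv.
  apply/seteqP; split => p.
    move=> vp x hx; have [ip _] := vp; split=> //.
    by rewrite !ell_RE//; [exact: (opt_RE ip bv).1|case: hx].
  move=> pv; have [ip _] := pv v (vertex_half vv).
  apply/opt_RE => // x hx; have [_] := pv x hx.
  by rewrite !ell_RE//; case: hx.
exists #|{ffun 'I_n -> bool}|, (fun k => opt_R (vertex_point R (enum_val k))).
split=> [k|]; first exact/opt_R_polyhedral/vertex_point_vertex.
rewrite exact_RE; apply/seteqP; split => p.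
  move=> [v /vertex_pointP[f ->] vp].
  by exists (enum_rank f) => //; rewrite enum_rankK.
move=> [k _ kp]; exists (vertex_point R (enum_val k)) => //.
exact: vertex_point_vertex.
Qed.
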